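(* Let $\Bbbk$ be a field and let $A$ and $B$ be finite-dimensional $\Bbbk$-algebras such that $A\leq_J B$. Then, for any finite-dimensional $\Bbbk$-algebra $C$, we have $A\otimes_\Bbbk C\leq_J B\otimes_\Bbbk C$ and $C\otimes_\Bbbk A\leq_J C\otimes_\Bbbk B$.
   Context: All algebras are finite-dimensional, associative, unital $\Bbbk$-algebras, and all (bi)modules are finite-dimensional. For $\Bbbk$-algebras $A,B$ one writes $A\geq_J B$ (equivalently $B\leq_J A$) if there are bimodules ${}_AM_B$ and ${}_BN_A$ such that $M\otimes_B N\simeq A\oplus X$ as $A$-$A$-bimodules for some $A$-$A$-bimodule $X$. *)

(* Defs.v *)
From HB Require Import structures.
From mathcomp Require Import ssreflect ssrfun ssrbool eqtype ssrnat seq choice.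
From mathcomp Require Import fintype finfun tuple bigop.
From mathcomp Require Import ssralg matrix vector falgebra sesquilinear.

Set Implicit Arguments.
Unset Strict Implicit.
Unset Printing Implicit Defensive.

Import GRing.Theory.
Local Open Scope ring_scope.

Notation bilin f := (bilinear_for
  (GRing.Scale.Law.clone _ _ *:%R _) (GRing.Scale.Law.clone _ _ *:%R _) f).

(* Finite-dimensional associative unital algebras. The library interfaces     *)
(* (algType, falgType) require 1 != 0; here the zero algebra is allowed, and  *)
(* falg below recovers every falgType.                                        *)
HB.mixin Record Vector_isFdAlgebra (K : fieldType) (A : Type) of Vector K A := {
  aone : A;
  amul : A -> A -> A;
  amul_bilin : bilin amul;
  amulA : associative amul;
  amul1l : left_id aone amul;
  amul1r : right_id aone amul
}.

#[short(type="fdAlgType")]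
HB.structure Definition FdAlgebra (K : fieldType) :=
  {A of Vector K A & Vector_isFdAlgebra K A}.

Arguments aone {K s}.
Arguments amul {K s}.

Section FromFalgebra.
Variables (K : fieldType) (A : falgType K).

Definition falg : Type := A.
HB.instance Definition _ := Vector.copy falg A.

Fact falg_mul_bilin : bilin ( *%R : falg -> A -> falg).
Proof.
by split=> [b|a] k x y /=; rewrite ?mulrDl ?mulrDr -?scalerAl -?scalerAr.
Qed.

HB.instance Definition _ := Vector_isFdAlgebra.Build K falg
  falg_mul_bilin (@mulrA A) (@mul1r A) (@mulr1 A).

End FromFalgebra.

(* Both actions of an A-B-bimodule are bilinear over K, so K acts centrally.  *)
HB.mixin Record Vector_isBimodule (K : fieldType) (A B : fdAlgType K)
    (M : Type) of Vector K M := {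
  lact : A -> M -> M;
  ract : M -> B -> M;
  lact_bilin : bilin lact;
  ract_bilin : bilin ract;
  lact1 : forall m, lact aone m = m;
  ract1 : forall m, ract m aone = m;
  lactM : forall a a' m, lact (amul a a') m = lact a (lact a' m);
  ractM : forall m b b', ract m (amul b b') = ract (ract m b) b';
  lact_ract : forall a m b, lact a (ract m b) = ract (lact a m) b
}.

#[short(type="bimodType")]
HB.structure Definition Bimodule (K : fieldType) (A B : fdAlgType K) :=
  {M of Vector K M & Vector_isBimodule K A B M}.

Arguments lact {K A B s}.
Arguments ract {K A B s}.

Section BimoduleIso.
Variables (K : fieldType) (A B : fdAlgType K).

Definition bimod_hom (M N : bimodType A B) (f : M -> N) : Prop :=
  [/\ linear f, forall a m, f (lact a m) = lact a (f m)
    & forall m b, f (ract m b) = ract (f m) b].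

Definition bimod_isog (M N : bimodType A B) : Prop :=
  exists2 f : M -> N, bimod_hom f & bijective f.

End BimoduleIso.

Section RegularBimodule.
Variables (K : fieldType) (A : fdAlgType K).

Definition regbimod : Type := A.
HB.instance Definition _ := Vector.copy regbimod A.
HB.instance Definition _ := @Vector_isBimodule.Build K A A regbimod amul amul
  amul_bilin amul_bilin amul1l amul1r
  (fun a a' m => esym (amulA a a' m)) (@amulA K A) (@amulA K A).

End RegularBimodule.

Section DirectSumBimodule.
Variables (K : fieldType) (A B : fdAlgType K) (M N : bimodType A B).

Definition dsum_lact (a : A) (x : M * N) : M * N := (lact a x.1, lact a x.2).
Definition dsum_ract (x : M * N) (b : B) : M * N := (ract x.1 b, ract x.2 b).

Fact dsum_lact_bilin : bilin dsum_lact.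
Proof.
by split=> [x|a] k y z; rewrite /dsum_lact /= !(lact_bilin.1, lact_bilin.2).
Qed.
Fact dsum_ract_bilin : bilin dsum_ract.
Proof.
by split=> [x|a] k y z; rewrite /dsum_ract /= !(ract_bilin.1, ract_bilin.2).
Qed.
Fact dsum_lact1 x : dsum_lact aone x = x.
Proof. by case: x => m n; rewrite /dsum_lact !lact1. Qed.
Fact dsum_ract1 x : dsum_ract x aone = x.
Proof. by case: x => m n; rewrite /dsum_ract !ract1. Qed.
Fact dsum_lactM a a' x :
  dsum_lact (amul a a') x = dsum_lact a (dsum_lact a' x).
Proof. by rewrite /dsum_lact !lactM. Qed.
Fact dsum_ractM x b b' :
  dsum_ract x (amul b b') = dsum_ract (dsum_ract x b) b'.
Proof. by rewrite /dsum_ract !ractM. Qed.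
Fact dsum_lact_ract a x b :
  dsum_lact a (dsum_ract x b) = dsum_ract (dsum_lact a x) b.
Proof. by rewrite /dsum_lact /dsum_ract /= !lact_ract. Qed.

HB.instance Definition _ := @Vector_isBimodule.Build K A B (M * N)%type
  dsum_lact dsum_ract dsum_lact_bilin dsum_ract_bilin dsum_lact1 dsum_ract1
  dsum_lactM dsum_ractM dsum_lact_ract.

End DirectSumBimodule.

(* The tensor product over K, as matrices of coordinates in bases of U and V. *)
(* It is characterized, independently of the bases, by the universal property *)
(* tens_bilin, tensv_liftE, eq_tensv.                                         *)
Section TensorVect.
Variables (K : fieldType) (U V : vectType K).

Definition tensv : Type := 'M[K]_(\dim {:U}, \dim {:V}).
HB.instance Definition _ := Vector.copy tensv 'M[K]_(\dim {:U}, \dim {:V}).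

Definition tens (u : U) (v : V) : tensv :=
  \matrix_(i, j) (coord (vbasis {:U}) i u * coord (vbasis {:V}) j v).

Definition tensv_lift (W : lmodType K) (f : U -> V -> W) (t : tensv) : W :=
  \sum_i \sum_j (t : 'M_(_, _)) i j *: f (vbasis {:U})`_i (vbasis {:V})`_j.

Lemma tens_bilin : bilin tens.
Proof.
split=> [v|u] k x y; apply/matrixP=> i j; rewrite !mxE linearP /=.
  by rewrite mulrDl mulrA.
by rewrite mulrDr mulrCA.
Qed.

Lemma tensv_lift_linear (W : lmodType K) (f : U -> V -> W) :
  linear (tensv_lift f).
Proof.
move=> k s t; rewrite /tensv_lift scaler_sumr -big_split; apply: eq_bigr => i _.
rewrite scaler_sumr -big_split; apply: eq_bigr => j _ /=.
by rewrite !mxE scalerDl scalerA.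
Qed.

HB.instance Definition _ (W : lmodType K) (f : U -> V -> W) :=
  GRing.isLinear.Build K tensv W _ (tensv_lift f) (tensv_lift_linear f).

Lemma tensv_liftE (W : lmodType K) (f : U -> V -> W) :
  bilin f -> forall u v, tensv_lift f (tens u v) = f u v.
Proof.
move=> fbil u v.
pose ff := bilinear_isBilinear.Build K U V W _ _ f fbil.
pose g : {bilinear U -> V -> W} := HB.pack f ff.
rewrite /tensv_lift -[RHS]/(g u v).
rewrite {2}(coord_vbasis (memvf u)) linear_sumlz; apply: eq_bigr => i _.
rewrite {2}(coord_vbasis (memvf v)) linear_sumr; apply: eq_bigr => j _.
by rewrite linearZlr /= !mxE scalerA.
Qed.

Lemma tensvE (t : tensv) :
  t = \sum_i \sum_j
        (t : 'M_(_, _)) i j *: tens (vbasis {:U})`_i (vbasis {:V})`_j.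
Proof.
rewrite [LHS]matrix_sum_delta; apply: eq_bigr => i _; apply: eq_bigr => j _.
congr (_ *: _); apply/matrixP=> k l; rewrite !mxE.
rewrite !coord_free ?(basis_free (vbasisP _)) //.
by rewrite -natrM mulnb (eq_sym i) (eq_sym j).
Qed.

Lemma tensv_ind (P : tensv -> Prop) :
    (forall k s t, P s -> P t -> P (k *: s + t)) ->
    (forall u v, P (tens u v)) -> forall t, P t.
Proof.
move=> Plin Ptens t.
have P0 : P 0 by rewrite -(addNr (tens 0 0)) -scaleN1r; apply: Plin.
have PD x y : P x -> P y -> P (x + y).
  by move=> Px Py; rewrite -[x]scale1r; apply: Plin.
rewrite (tensvE t); apply: (big_ind P) => // i _; apply: (big_ind P) => // j _.
by rewrite -[_ *: _]addr0; apply: Plin.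
Qed.

Lemma eq_tensv (W : lmodType K) (f g : tensv -> W) :
  linear f -> linear g -> (forall u v, f (tens u v) = g (tens u v)) -> f =1 g.
Proof.
move=> fl gl fg; elim/tensv_ind => [k s t IHs IHt|]; last exact: fg.
by rewrite fl gl IHs IHt.
Qed.

Lemma tensv_lift_comb (W : lmodType K) (k : K) (f g h : U -> V -> W) :
    (forall u v, f u v = k *: g u v + h u v) ->
  forall t, tensv_lift f t = k *: tensv_lift g t + tensv_lift h t.
Proof.
move=> fgh t; rewrite /tensv_lift.
rewrite scaler_sumr -big_split; apply: eq_bigr => i _ /=.
rewrite scaler_sumr -big_split; apply: eq_bigr => j _ /=.
by rewrite fgh scalerDr !scalerA mulrC.
Qed.

End TensorVect.

Arguments tens {K U V}.
Arguments tens_bilin {K U V}.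
Arguments tensv_lift {K U V W}.

Section TensorMap.
Variables (K : fieldType) (U V U' V' : vectType K).

Definition tensv_map (f : U -> U') (g : V -> V') : tensv U V -> tensv U' V' :=
  tensv_lift (fun u v => tens (f u) (g v)).

Fact tensv_map_linear f g : linear (tensv_map f g).
Proof. exact: tensv_lift_linear. Qed.

Lemma tensv_mapE (f : U -> U') (g : V -> V') :
  linear f -> linear g ->
  forall u v, tensv_map f g (tens u v) = tens (f u) (g v).
Proof.
move=> fl gl; apply: tensv_liftE.
by split=> [w|w] k x y /=; rewrite ?fl ?gl ?tens_bilin.1 ?tens_bilin.2.
Qed.

Lemma tensv_map_combl k (f f1 f2 : U -> U') (g : V -> V') :
    (forall u, f u = k *: f1 u + f2 u) ->
  forall t, tensv_map f g t = k *: tensv_map f1 g t + tensv_map f2 g t.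
Proof.
by move=> fE; apply: tensv_lift_comb => u v; rewrite fE tens_bilin.1.
Qed.

Lemma tensv_map_combr k (f : U -> U') (g g1 g2 : V -> V') :
    (forall v, g v = k *: g1 v + g2 v) ->
  forall t, tensv_map f g t = k *: tensv_map f g1 t + tensv_map f g2 t.
Proof.
by move=> gE; apply: tensv_lift_comb => u v; rewrite gE tens_bilin.2.
Qed.

End TensorMap.

(* The product on A (x)_K C is (a (x) c)(a' (x) c') = aa' (x) cc', see        *)
(* tensv_mulE.                                                                *)
Section TensorAlgebra.
Variables (K : fieldType) (A C : fdAlgType K).

Definition tensv_one : tensv A C := tens aone aone.

Definition tensv_mul (s t : tensv A C) : tensv A C :=
  tensv_lift (fun a c => tensv_map (amul a) (amul c) t) s.

Fact tensv_mul_bilin : bilin tensv_mul.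
Proof.
split=> [t|s] k x y /=; first exact: tensv_lift_linear.
by apply: tensv_lift_comb => a c; apply: tensv_map_linear.
Qed.

Lemma tensv_mulE a c a' c' :
  tensv_mul (tens a c) (tens a' c') = tens (amul a a') (amul c c').
Proof.
rewrite /tensv_mul tensv_liftE; last first.
  split=> [c2|a2] k x y /=.
    by apply: tensv_map_combl => b; apply: amul_bilin.1.
  by apply: tensv_map_combr => b; apply: amul_bilin.1.
by apply: tensv_mapE; apply: amul_bilin.2.
Qed.

Fact tensv_mulA : associative tensv_mul.
Proof.
move=> s t r; elim/tensv_ind: s => [k s s' IHs IHs'|a c].
  by rewrite !tensv_mul_bilin.1 IHs IHs'.
elim/tensv_ind: t => [k t t' IHt IHt'|a' c'].
  by rewrite !(tensv_mul_bilin.1, tensv_mul_bilin.2) IHt IHt'.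
elim/tensv_ind: r => [k r r' IHr IHr'|a'' c''].
  by rewrite !tensv_mul_bilin.2 IHr IHr'.
by rewrite !tensv_mulE !amulA.
Qed.

Fact tensv_mul1l : left_id tensv_one tensv_mul.
Proof.
elim/tensv_ind => [k s t IHs IHt|a c].
  by rewrite tensv_mul_bilin.2 IHs IHt.
by rewrite tensv_mulE !amul1l.
Qed.

Fact tensv_mul1r : right_id tensv_one tensv_mul.
Proof.
elim/tensv_ind => [k s t IHs IHt|a c].
  by rewrite tensv_mul_bilin.1 IHs IHt.
by rewrite tensv_mulE !amul1r.
Qed.

HB.instance Definition _ := Vector_isFdAlgebra.Build K (tensv A C)
  tensv_mul_bilin tensv_mulA tensv_mul1l tensv_mul1r.

End TensorAlgebra.

Arguments tensv_mul_bilin {K A C}.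

(* The quotient of V by a subspace U, realized on the complement U^C.         *)
Section QuotientVect.
Variables (K : fieldType) (V : vectType K) (U : {vspace V}).

Definition quotv : Type := subvs_of (U^C)%VS.
HB.instance Definition _ := Vector.copy quotv (subvs_of (U^C)%VS).

Definition quotv_repr (q : quotv) : V := vsval q.
Definition quotv_pi (v : V) : quotv := vsproj (U^C) (v - projv U v).

Fact quotv_repr_linear : linear quotv_repr.
Proof. exact: linearP. Qed.

Fact quotv_pi_linear : linear quotv_pi.
Proof.
move=> k x y; rewrite /quotv_pi -[RHS]linearP; congr (vsproj _ _).
by rewrite linearP scalerBr opprD addrACA.
Qed.

Lemma quotv_reprK : cancel quotv_repr quotv_pi.
Proof.
move=> q; rewrite /quotv_pi /quotv_repr.
suff -> : projv U (vsval q) = 0 by rewrite subr0 vsvalK.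
have := daddv_pi_add (capv_compl U) (w := vsval q).
rewrite addv_complf memvf => /(_ isT).
rewrite (@daddv_pi_id _ _ (U^C)%VS) ?subvsP 1?capvC ?capv_compl // => /eqP.
by rewrite -subr_eq0 addrK => /eqP.
Qed.

Lemma quotv_pi_eq0 v : (quotv_pi v == 0) = (v \in U).
Proof.
apply/eqP/idP => [/(congr1 vsval)|vU].
  rewrite vsprojK ?memv_projC // linear0 => /eqP; rewrite subr_eq0 => /eqP ->.
  exact: memv_proj.
by rewrite /quotv_pi projv_id // subrr linear0.
Qed.

Lemma quotv_piK v : v - quotv_repr (quotv_pi v) \in U.
Proof.
rewrite -quotv_pi_eq0 -scaleN1r addrC quotv_pi_linear quotv_reprK.
by rewrite scaleN1r addNr.
Qed.

End QuotientVect.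

(* M (x)_B N is the quotient of M (x)_K N by the span of the elements         *)
(* mb (x) n - m (x) bn. It suffices to let m, b, n range over bases:          *)
(* balv_mem and balv_sub show that balv is the span of all of them. The       *)
(* actions are given on elementary tensors by tensB_lactE and tensB_ractE.    *)
Section TensorOver.
Variables (K : fieldType) (A B C : fdAlgType K).
Variables (M : bimodType A B) (N : bimodType B C).

Definition balv_rel (m : M) (b : B) (n : N) : tensv M N :=
  tens (ract m b) n - tens m (lact b n).

Definition balv : {vspace tensv M N} :=
  (\sum_(i < \dim {:M}) \sum_(j < \dim {:B}) \sum_(l < \dim {:N})
     <[balv_rel (vbasis {:M})`_i (vbasis {:B})`_j (vbasis {:N})`_l]>)%VS.

Lemma balv_sub (X : {vspace tensv M N}) :
  (forall m b n, balv_rel m b n \in X) -> (balv <= X)%VS.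
Proof.
by move=> relX; do 3!apply/subv_sumP => ? _; rewrite -memvE.
Qed.

Let linear_memv (U W : vectType K) (f : U -> W) (X : {vspace W}) :
  linear f -> (forall i : 'I_(\dim {:U}), f (vbasis {:U})`_i \in X) ->
  forall u, f u \in X.
Proof.
move=> fl fX u.
pose f1 := GRing.isLinear.Build K U W _ f fl.
pose f' : {linear U -> W} := HB.pack f f1.
rewrite -[f u]/(f' u) (coord_vbasis (memvf u)) linear_sum.
by apply: memv_suml => i _; rewrite linearZ memvZ //; apply: fX.
Qed.

Let subDD (V : vectType K) (k : K) (x1 y1 x2 y2 : V) :
  k *: x1 + y1 - (k *: x2 + y2) = k *: (x1 - x2) + (y1 - y2).
Proof. by rewrite scalerBr opprD addrACA. Qed.

Lemma balv_mem m b n : balv_rel m b n \in balv.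
Proof.
apply: (linear_memv (f := fun m => balv_rel m b n)) => [k x y|i].
  by rewrite /balv_rel ract_bilin.1 !tens_bilin.1 subDD.
apply: (linear_memv (f := fun b => balv_rel _ b n)) => [k x y|j].
  rewrite /balv_rel ract_bilin.2 lact_bilin.1.
  by rewrite tens_bilin.1 tens_bilin.2 subDD.
apply: (linear_memv (f := fun n => balv_rel _ _ n)) => [k x y|l].
  by rewrite /balv_rel lact_bilin.2 !tens_bilin.2 subDD.
by rewrite memvE /balv (sumv_sup i) // (sumv_sup j) // (sumv_sup l).
Qed.

Definition tensB : Type := quotv balv.
HB.instance Definition _ := Vector.copy tensB (quotv balv).

Definition tensb (m : M) (n : N) : tensB := quotv_pi balv (tens m n).

Lemma tensb_bilin : bilin tensb.
Proof.
split=> [n|m] k x y; rewrite /tensb -quotv_pi_linear.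
  by rewrite tens_bilin.1.
by rewrite tens_bilin.2.
Qed.

Lemma tensb_balanced m b n : tensb (ract m b) n = tensb m (lact b n).
Proof.
apply/eqP; rewrite -subr_eq0 addrC -scaleN1r -quotv_pi_linear quotv_pi_eq0.
by rewrite scaleN1r addrC balv_mem.
Qed.

Lemma tensB_ind (P : tensB -> Prop) :
    (forall k s t, P s -> P t -> P (k *: s + t)) ->
    (forall m n, P (tensb m n)) -> forall t, P t.
Proof.
move=> Plin Ptens t; rewrite -(quotv_reprK t).
elim/tensv_ind: (quotv_repr t) => [k x y Px Py|]; last exact: Ptens.
by rewrite quotv_pi_linear; apply: Plin.
Qed.

Definition tensB_lift (W : lmodType K) (f : M -> N -> W) (t : tensB) : W :=
  tensv_lift f (quotv_repr t).

Lemma tensB_lift_linear (W : lmodType K) (f : M -> N -> W) :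
  linear (tensB_lift f).
Proof.
by move=> k x y; rewrite /tensB_lift quotv_repr_linear tensv_lift_linear.
Qed.

Lemma tensB_lift_pi (W : vectType K) (f : M -> N -> W) :
    bilin f -> (forall m b n, f (ract m b) n = f m (lact b n)) ->
  forall t, tensB_lift f (quotv_pi balv t) = tensv_lift f t.
Proof.
move=> fbil fbal t; pose g := linfun (tensv_lift f).
have /subvP kerg : (balv <= lker g)%VS.
  apply: balv_sub => m b n.
  by rewrite memv_ker linearB /= !lfunE /= !tensv_liftE // fbal subrr.
apply/esym/eqP; rewrite -subr_eq0 -linearB /=.
by have := kerg _ (quotv_piK balv t); rewrite memv_ker lfunE.
Qed.

Lemma tensB_liftE (W : vectType K) (f : M -> N -> W) :
    bilin f -> (forall m b n, f (ract m b) n = f m (lact b n)) ->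
  forall m n, tensB_lift f (tensb m n) = f m n.
Proof. by move=> fbil fbal m n; rewrite tensB_lift_pi // tensv_liftE. Qed.

Definition tensB_lact (a : A) (t : tensB) : tensB :=
  tensB_lift (fun m n => tensb (lact a m) n) t.

Definition tensB_ract (t : tensB) (c : C) : tensB :=
  tensB_lift (fun m n => tensb m (ract n c)) t.

Lemma tensB_lactE a m n : tensB_lact a (tensb m n) = tensb (lact a m) n.
Proof.
apply: (tensB_liftE (f := fun m n => tensb (lact a m) n)) => [|m' b n'].
  split=> [n'|m'] k x y /=; last exact: tensb_bilin.2.
  by rewrite lact_bilin.2 tensb_bilin.1.
by rewrite lact_ract tensb_balanced.
Qed.

Lemma tensB_ractE m n c : tensB_ract (tensb m n) c = tensb m (ract n c).
Proof.
apply: (tensB_liftE (f := fun m n => tensb m (ract n c))) => [|m' b n'].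
  split=> [n'|m'] k x y /=; first exact: tensb_bilin.1.
  by rewrite ract_bilin.1 tensb_bilin.2.
by rewrite tensb_balanced lact_ract.
Qed.

Fact tensB_lact_bilin : bilin tensB_lact.
Proof.
split=> [t|a] k x y; last exact: tensB_lift_linear.
by apply: tensv_lift_comb => m n; rewrite lact_bilin.1 tensb_bilin.1.
Qed.

Fact tensB_ract_bilin : bilin tensB_ract.
Proof.
split=> [c|t] k x y; first exact: tensB_lift_linear.
by apply: tensv_lift_comb => m n; rewrite ract_bilin.2 tensb_bilin.2.
Qed.

Fact tensB_lact1 t : tensB_lact aone t = t.
Proof.
elim/tensB_ind: t => [k s t IHs IHt|m n].
  by rewrite tensB_lact_bilin.2 IHs IHt.
by rewrite tensB_lactE lact1.
Qed.

Fact tensB_ract1 t : tensB_ract t aone = t.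
Proof.
elim/tensB_ind: t => [k s t IHs IHt|m n].
  by rewrite tensB_ract_bilin.1 IHs IHt.
by rewrite tensB_ractE ract1.
Qed.

Fact tensB_lactM a a' t :
  tensB_lact (amul a a') t = tensB_lact a (tensB_lact a' t).
Proof.
elim/tensB_ind: t => [k s t IHs IHt|m n].
  by rewrite !tensB_lact_bilin.2 IHs IHt.
by rewrite !tensB_lactE lactM.
Qed.

Fact tensB_ractM t c c' :
  tensB_ract t (amul c c') = tensB_ract (tensB_ract t c) c'.
Proof.
elim/tensB_ind: t => [k s t IHs IHt|m n].
  by rewrite !tensB_ract_bilin.1 IHs IHt.
by rewrite !tensB_ractE ractM.
Qed.

Fact tensB_lact_ract a t c :
  tensB_lact a (tensB_ract t c) = tensB_ract (tensB_lact a t) c.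
Proof.
elim/tensB_ind: t => [k s t IHs IHt|m n].
  by rewrite tensB_ract_bilin.1 !tensB_lact_bilin.2 tensB_ract_bilin.1 IHs IHt.
by rewrite tensB_ractE !tensB_lactE tensB_ractE.
Qed.

HB.instance Definition _ := @Vector_isBimodule.Build K A C tensB
  tensB_lact tensB_ract tensB_lact_bilin tensB_ract_bilin
  tensB_lact1 tensB_ract1 tensB_lactM tensB_ractM tensB_lact_ract.

End TensorOver.

Arguments tensb {K A B C M N}.
Arguments tensb_bilin {K A B C M N}.
Arguments tensB_lift {K A B C M N W}.

Section JOrder.
Variable K : fieldType.

Definition geJ (A B : fdAlgType K) : Prop :=
  exists (M : bimodType A B) (N : bimodType B A) (X : bimodType A A),
    bimod_isog (tensB M N) (regbimod A * X)%type.

Definition leJ (A B : fdAlgType K) : Prop := geJ B A.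

End JOrder.

(* Main.v *)
Require Import Defs.
From HB Require Import structures.
From mathcomp Require Import ssreflect ssrfun ssrbool eqtype choice.
From mathcomp Require Import ssralg vector.

(** The relation [geJ A B] says that the regular bimodule [A] is a direct
    summand of some [M (x)_B N], and a direct summand is a retract: there are
    bimodule maps [A -> M (x)_B N -> A] composing to the identity. The first map
    is determined by the image [z] of [1], which can be any element with
    [a z = z a] for all [a]; the second is a balanced, bilinear, [A]-linear
    pairing [p : M -> N -> A]; and the composite is the identity exactly when
    [p] maps [z] to [1]. So [geJ A B] amounts to the existence of such a pair
    [(p, z)] ([geJ_retract]).

    Such pairs can be tensored over the base field. If [(p, z)] witnesses
    [geJ A B] and [(q, w)] witnesses [geJ C D], then the pairing
    [(m (x) x, n (x) y) |-> p m n (x) q x y] of [M (x) P] with [N (x) Q],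
    together with the image of [(z, w)] under the shuffle
    [(m (x) n, x (x) y) |-> (m (x) x) (x) (n (x) y)], witnesses
    [geJ (A (x) C) (B (x) D)] ([geJ_tens]): everything is checked on elementary
    tensors, where both the pairing and the shuffle are explicit. As [geJ C C]
    holds ([geJ_refl]), tensoring with [C] on either side preserves the
    relation. Working with the pairs [(p, z)] avoids both the complement [X] and
    the interchange isomorphism
    [(M (x) P) (x)_(B (x) D) (N (x) Q) = (M (x)_B N) (x) (P (x)_D Q)]. *)

Set Implicit Arguments.
Unset Strict Implicit.
Unset Printing Implicit Defensive.

Import GRing.Theory.
Local Open Scope ring_scope.

(** * Tensor products of bilinear maps and of bimodules *)

Section TensorBilinear.
Variables (K : fieldType) (U V W U' V' W' : vectType K).

(** The actions on [M (x) P] and the tensor product of two pairings are all of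
    this form. *)
Definition tens2 (f : U -> V -> W) (g : U' -> V' -> W')
    (s : tensv U U') (t : tensv V V') : tensv W W' :=
  tensv_lift (fun u u' => tensv_map (f u) (g u') t) s.

Lemma tens2_bilin f g : bilin (tens2 f g).
Proof.
split=> [t|s] k x y /=; first exact: tensv_lift_linear.
by apply: tensv_lift_comb => u u'; apply: tensv_map_linear.
Qed.

Lemma tens2E f g : bilin f -> bilin g -> forall u u' v v',
  tens2 f g (tens u u') (tens v v') = tens (f u v) (g u' v').
Proof.
move=> fbil gbil u u' v v'; rewrite /tens2 tensv_liftE.
  by apply: tensv_mapE; [apply: fbil.2 | apply: gbil.2].
split=> [x'|x] k x1 x2 /=.
  by apply: tensv_map_combl => y; apply: fbil.1.
by apply: tensv_map_combr => y; apply: gbil.1.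
Qed.

End TensorBilinear.

Section TensorBimodule.
Variables (K : fieldType) (A B C D : fdAlgType K).
Variables (M : bimodType A B) (P : bimodType C D).

Let T := tensv M P.
Let tlact : tensv A C -> T -> T := tens2 lact lact.
Let tract : T -> tensv B D -> T := tens2 ract ract.

Let tlact_bilin : bilin tlact. Proof. exact: tens2_bilin. Qed.
Let tract_bilin : bilin tract. Proof. exact: tens2_bilin. Qed.

Let tlactE a c m x : tlact (tens a c) (tens m x) = tens (lact a m) (lact c x).
Proof. by apply: tens2E; apply: lact_bilin. Qed.

Let tractE m x b d : tract (tens m x) (tens b d) = tens (ract m b) (ract x d).
Proof. by apply: tens2E; apply: ract_bilin. Qed.

Fact tensv_lact1 t : tlact aone t = t.
Proof.
elim/tensv_ind: t => [k s t IHs IHt|m x]; first by rewrite tlact_bilin.2 IHs IHt.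
by rewrite tlactE !lact1.
Qed.

Fact tensv_ract1 t : tract t aone = t.
Proof.
elim/tensv_ind: t => [k s t IHs IHt|m x]; first by rewrite tract_bilin.1 IHs IHt.
by rewrite tractE !ract1.
Qed.

Fact tensv_lactM r s t : tlact (amul r s) t = tlact r (tlact s t).
Proof.
elim/tensv_ind: t => [k t t' IH IH'|m x]; first by rewrite !tlact_bilin.2 IH IH'.
elim/tensv_ind: r => [k r r' IH IH'|a c].
  by rewrite amul_bilin.1 !tlact_bilin.1 IH IH'.
elim/tensv_ind: s => [k s s' IH IH'|a' c'].
  by rewrite amul_bilin.2 !tlact_bilin.1 tlact_bilin.2 IH IH'.
by rewrite [amul _ _]tensv_mulE !tlactE !lactM.
Qed.

Fact tensv_ractM t r s : tract t (amul r s) = tract (tract t r) s.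
Proof.
elim/tensv_ind: t => [k t t' IH IH'|m x]; first by rewrite !tract_bilin.1 IH IH'.
elim/tensv_ind: r => [k r r' IH IH'|b d].
  by rewrite amul_bilin.1 !tract_bilin.2 tract_bilin.1 IH IH'.
elim/tensv_ind: s => [k s s' IH IH'|b' d'].
  by rewrite amul_bilin.2 !tract_bilin.2 IH IH'.
by rewrite [amul _ _]tensv_mulE !tractE !ractM.
Qed.

Fact tensv_lact_ract r t s : tlact r (tract t s) = tract (tlact r t) s.
Proof.
elim/tensv_ind: t => [k t t' IH IH'|m x].
  by rewrite tract_bilin.1 !tlact_bilin.2 tract_bilin.1 IH IH'.
elim/tensv_ind: r => [k r r' IH IH'|a c].
  by rewrite !tlact_bilin.1 tract_bilin.1 IH IH'.
elim/tensv_ind: s => [k s s' IH IH'|b d].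
  by rewrite !tract_bilin.2 tlact_bilin.2 IH IH'.
by rewrite tractE !tlactE tractE !lact_ract.
Qed.

HB.instance Definition _ :=
  @Vector_isBimodule.Build K (tensv A C) (tensv B D) (tensv M P)
    tlact tract tlact_bilin tract_bilin tensv_lact1 tensv_ract1
    tensv_lactM tensv_ractM tensv_lact_ract.

Lemma tensv_lactE a c (m : M) (x : P) :
  lact (tens a c) (tens m x) = tens (lact a m) (lact c x).
Proof. exact: tlactE. Qed.

Lemma tensv_ractE (m : M) (x : P) b d :
  ract (tens m x) (tens b d) = tens (ract m b) (ract x d).
Proof. exact: tractE. Qed.

End TensorBimodule.

(** * Kernels and split epimorphisms onto the regular bimodule *)

Section BimoduleSub.
Variables (K : fieldType) (A B : fdAlgType K) (M : bimodType A B).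

Lemma lactB a (m n : M) : lact a (m - n) = lact a m - lact a n.
Proof. by rewrite addrC -scaleN1r lact_bilin.2 /= scaleN1r addrC. Qed.

Lemma ractB (m n : M) b : ract (m - n) b = ract m b - ract n b.
Proof. by rewrite addrC -scaleN1r ract_bilin.1 /= scaleN1r addrC. Qed.

Lemma lact0 a : lact a (0 : M) = 0.
Proof. by rewrite -[X in lact a X](subrr 0) lactB subrr. Qed.

Lemma ract0 b : ract (0 : M) b = 0.
Proof. by rewrite -[X in ract X b](subrr 0) ractB subrr. Qed.

End BimoduleSub.

Section KernelBimodule.
Variables (K : fieldType) (A B : fdAlgType K) (M N : bimodType A B).
Variables (f : {linear M -> N}).
Hypothesis fL : forall a m, f (lact a m) = lact a (f m).
Hypothesis fR : forall m b, f (ract m b) = ract (f m) b.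

(** The compatibility proofs are arguments of the type, so that unification can
    recover them when it infers the bimodule structure. *)
Definition kerbimod of (forall a m, f (lact a m) = lact a (f m))
  & (forall m b, f (ract m b) = ract (f m) b) : Type :=
  subvs_of (lker (linfun f)).
Local Notation kerT := (kerbimod fL fR).
HB.instance Definition _ := Vector.copy kerT (subvs_of (lker (linfun f))).

Lemma ker_memE m : (m \in lker (linfun f)) = (f m == 0).
Proof. by rewrite memv_ker lfunE. Qed.

Let klact (a : A) (x : kerT) : kerT := vsproj _ (lact a (vsval x)).
Let kract (x : kerT) (b : B) : kerT := vsproj _ (ract (vsval x) b).

Let klactE a x : vsval (klact a x) = lact a (vsval x).
Proof.
rewrite vsprojK // ker_memE fL; have := subvsP x.
by rewrite ker_memE => /eqP ->; rewrite lact0.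
Qed.

Let kractE x b : vsval (kract x b) = ract (vsval x) b.
Proof.
rewrite vsprojK // ker_memE fR; have := subvsP x.
by rewrite ker_memE => /eqP ->; rewrite ract0.
Qed.

Fact ker_lact_bilin : bilin klact.
Proof.
split=> [x|a] k y z; apply: val_inj; rewrite /= !klactE.
  exact: lact_bilin.1.
by rewrite linearP; apply: lact_bilin.2.
Qed.

Fact ker_ract_bilin : bilin kract.
Proof.
split=> [b|x] k y z; apply: val_inj; rewrite /= !kractE.
  by rewrite linearP; apply: ract_bilin.1.
exact: ract_bilin.2.
Qed.

Fact ker_lact1 x : klact aone x = x.
Proof. by apply: val_inj; rewrite /= klactE lact1. Qed.

Fact ker_ract1 x : kract x aone = x.
Proof. by apply: val_inj; rewrite /= kractE ract1. Qed.

Fact ker_lactM a a' x : klact (amul a a') x = klact a (klact a' x).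
Proof. by apply: val_inj; rewrite /= !klactE lactM. Qed.

Fact ker_ractM x b b' : kract x (amul b b') = kract (kract x b) b'.
Proof. by apply: val_inj; rewrite /= !kractE ractM. Qed.

Fact ker_lact_ract a x b : klact a (kract x b) = kract (klact a x) b.
Proof. by apply: val_inj; rewrite /= !(klactE, kractE) lact_ract. Qed.

HB.instance Definition _ := @Vector_isBimodule.Build K A B kerT
  klact kract ker_lact_bilin ker_ract_bilin ker_lact1 ker_ract1
  ker_lactM ker_ractM ker_lact_ract.

Lemma ker_lactE a (x : kerT) : vsval (lact a x) = lact a (vsval x).
Proof. exact: klactE. Qed.

Lemma ker_ractE (x : kerT) b : vsval (ract x b) = ract (vsval x) b.
Proof. exact: kractE. Qed.

End KernelBimodule.

(** The element [z] defines the section [a |-> a z] of [f]; it is a map of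
    bimodules because [z] is central, so [T] is [A] plus the kernel of [f]. *)
Lemma split_regbimod (K : fieldType) (A : fdAlgType K) (T : bimodType A A)
    (f : T -> regbimod A) (z : T) :
  bimod_hom f -> (forall a, lact a z = ract z a) -> f z = aone ->
  exists X : bimodType A A, bimod_isog T (regbimod A * X)%type.
Proof.
move=> [flin fL fR] zC fz.
pose f' : {linear T -> regbimod A} :=
  HB.pack f (GRing.isLinear.Build K T (regbimod A) _ f flin).
exists (kerbimod (f := f') fL fR).
pose r (t : T) : kerbimod (f := f') fL fR := vsproj _ (t - lact (f t) z).
have rE t : vsval (r t) = t - lact (f t) z.
  rewrite vsprojK // ker_memE linearB /= fL fz.
  by rewrite [lact (f t) _]amul1r subrr.
exists (fun t => (f t, r t)); last first.
  exists (fun ax => lact (ax.1 : A) z + vsval ax.2) => [t|[a x]] /=.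
    by rewrite rE addrC subrK.
  have fx : f (lact (a : A) z + vsval x) = a.
    rewrite -[f _]/(f' _) linearD /= fL fz [lact _ _]amul1r.
    by have := subvsP x; rewrite ker_memE => /eqP /= ->; rewrite addr0.
  by congr pair => //; apply: val_inj; rewrite [LHS]rE fx addrC addKr.
split=> [k s t|a t|t a].
- congr pair; first exact: flin.
  apply: val_inj; rewrite [LHS]rE flin lact_bilin.1 /=.
  by rewrite !rE scalerBr opprD addrACA.
- congr pair; first exact: fL.
  apply: val_inj; rewrite [LHS]rE [RHS]ker_lactE rE lactB fL.
  by rewrite [lact a (f t)]/(amul a (f t)) lactM.
- congr pair; first exact: fR.
  apply: val_inj; rewrite [LHS]rE [RHS]ker_ractE rE ractB fR.
  by rewrite [ract (f t) a]/(amul (f t) a) lactM zC lact_ract.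
Qed.

(** * Retracts of tensor products over an algebra *)

Section Retract.
Variables (K : fieldType) (A B : fdAlgType K).

Record bimod_pairing (M : bimodType A B) (N : bimodType B A)
    (p : M -> N -> A) : Prop := BimodPairing {
  pairing_bilin : bilin p;
  pairing_balanced : forall m b n, p (ract m b) n = p m (lact b n);
  pairing_lact : forall a m n, p (lact a m) n = amul a (p m n);
  pairing_ract : forall m n a, p m (ract n a) = amul (p m n) a
}.

Definition retract (M : bimodType A B) (N : bimodType B A)
    (p : M -> N -> A) (z : tensB M N) : Prop :=
  [/\ bimod_pairing p, forall a : A, lact a z = ract z a
    & tensB_lift p z = aone].

(** The image [z] of [1] under the inclusion of [A] is central because [1] is;
    conversely the lift of [p] is split by [a |-> a z]. *)
Lemma geJ_retract :
  geJ A B <-> exists (M : bimodType A B) (N : bimodType B A) p z,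
                @retract M N p z.
Proof.
split=> [[M [N [X [f [flin fL fR] [g fK gK]]]]]|[M [N [p [z [pP zC pz]]]]]].
  pose p (m : M) (n : N) : A := (f (tensb m n)).1.
  have pP : bimod_pairing p.
    split=> [|m b n|a m n|m n a]; rewrite /p.
    - by split=> [n|m] k x y /=; rewrite ?tensb_bilin.1 ?tensb_bilin.2 flin.
    - by rewrite tensb_balanced.
    - by rewrite -tensB_lactE -[tensB_lact _ _]/(lact _ _) fL.
    - by rewrite -tensB_ractE -[tensB_ract _ _]/(ract _ _) fR.
  have pE t : tensB_lift p t = (f t).1.
    elim/tensB_ind: t => [k s t IHs IHt|m n].
      by rewrite tensB_lift_linear flin IHs IHt.
    by apply: tensB_liftE; [apply: pairing_bilin | apply: pairing_balanced].
  exists M, N, p, (g (aone, 0)); split=> // [a|]; last by rewrite pE gK.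
  apply: (can_inj fK); rewrite fL fR !gK; congr pair; last by rewrite /= lact0 ract0.
  by rewrite /= [LHS]amul1r [RHS]amul1l.
have pE := tensB_liftE (pairing_bilin pP) (pairing_balanced pP).
have [|X isoX] := @split_regbimod K A (tensB M N) (tensB_lift p) z _ zC pz.
  split=> [|a t|t a]; first exact: tensB_lift_linear.
    elim/tensB_ind: t => [k s t IHs IHt|m n].
      by rewrite lact_bilin.2 !tensB_lift_linear IHs IHt lact_bilin.2.
    by rewrite [lact a _]tensB_lactE !pE (pairing_lact pP).
  elim/tensB_ind: t => [k s t IHs IHt|m n].
    by rewrite ract_bilin.1 !tensB_lift_linear IHs IHt ract_bilin.1.
  by rewrite [ract _ a]tensB_ractE !pE (pairing_ract pP).
by exists M, N, X.
Qed.

End Retract.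

Lemma geJ_refl (K : fieldType) (A : fdAlgType K) : geJ A A.
Proof.
apply/geJ_retract; exists (regbimod A), (regbimod A), amul,
  (tensb (aone : regbimod A) (aone : regbimod A)).
have amulP : @bimod_pairing K A A (regbimod A) (regbimod A) amul.
  split=> [|m b n|a m n|m n a]; [exact: amul_bilin | by rewrite [RHS]amulA
    | by rewrite [RHS]amulA | by rewrite -[RHS]amulA].
split=> // [a|]; last first.
  by rewrite (tensB_liftE (pairing_bilin amulP) (pairing_balanced amulP)) amul1l.
rewrite [LHS]tensB_lactE [RHS]tensB_ractE.
have -> : lact a (aone : regbimod A) = ract (aone : regbimod A) a.
  by rewrite [LHS]amul1r [RHS]amul1l.
by rewrite tensb_balanced; congr tensb; rewrite [LHS]amul1r [RHS]amul1l.
Qed.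

(** * Tensor products of retracts *)

Section TensorRetract.
Variables (K : fieldType) (A B C D : fdAlgType K).
Variables (M : bimodType A B) (N : bimodType B A).
Variables (P : bimodType C D) (Q : bimodType D C).

Lemma bimod_pairing_tens (p : M -> N -> A) (q : P -> Q -> C) :
  bimod_pairing p -> bimod_pairing q ->
  @bimod_pairing K (tensv A C) (tensv B D) (tensv M P) (tensv N Q) (tens2 p q).
Proof.
move=> pP qP; have pqbil := tens2_bilin p q.
have pqE := tens2E (pairing_bilin pP) (pairing_bilin qP).
split=> // [s b t|a s t|s t a].
- elim/tensv_ind: s => [k s s' IH IH'|m x].
    by rewrite ract_bilin.1 !pqbil.1 IH IH'.
  elim/tensv_ind: t => [k t t' IH IH'|n y].
    by rewrite lact_bilin.2 !pqbil.2 IH IH'.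
  elim/tensv_ind: b => [k b b' IH IH'|b d].
    by rewrite ract_bilin.2 lact_bilin.1 pqbil.1 pqbil.2 IH IH'.
  rewrite tensv_ractE tensv_lactE !pqE.
  by rewrite (pairing_balanced pP) (pairing_balanced qP).
- elim/tensv_ind: s => [k s s' IH IH'|m x].
    by rewrite lact_bilin.2 !pqbil.1 IH IH' amul_bilin.2.
  elim/tensv_ind: t => [k t t' IH IH'|n y].
    by rewrite !pqbil.2 IH IH' amul_bilin.2.
  elim/tensv_ind: a => [k a a' IH IH'|a c].
    by rewrite lact_bilin.1 pqbil.1 IH IH' amul_bilin.1.
  rewrite tensv_lactE !pqE [RHS]tensv_mulE.
  by rewrite (pairing_lact pP) (pairing_lact qP).
- elim/tensv_ind: s => [k s s' IH IH'|m x].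
    by rewrite !pqbil.1 IH IH' amul_bilin.1.
  elim/tensv_ind: t => [k t t' IH IH'|n y].
    by rewrite ract_bilin.1 !pqbil.2 IH IH' amul_bilin.1.
  elim/tensv_ind: a => [k a a' IH IH'|a c].
    by rewrite ract_bilin.2 pqbil.2 IH IH' amul_bilin.2.
  rewrite tensv_ractE !pqE [RHS]tensv_mulE.
  by rewrite (pairing_ract pP) (pairing_ract qP).
Qed.

Let MN := tensB M N.
Let PQ := tensB P Q.
Let MPNQ := tensB (tensv M P) (tensv N Q).

Definition shuffle (z : MN) (w : PQ) : MPNQ :=
  tensB_lift (fun m n => tensB_lift
    (fun x y => tensb (tens m x : tensv M P) (tens n y : tensv N Q)) w) z.

Lemma shuffle_bilin : bilin shuffle.
Proof.
split=> [w|z] k s t /=; first exact: tensB_lift_linear.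
by apply: tensv_lift_comb => m n; apply: tensB_lift_linear.
Qed.

(** The two lifts are well defined because balancing over [B] is balancing over
    [B (x) D] by [b (x) 1], and balancing over [D] is balancing by [1 (x) d]. *)
Lemma shuffleE m n x y :
  shuffle (tensb m n) (tensb x y) = tensb (tens m x) (tens n y).
Proof.
have inE (m' : M) (n' : N) (x' : P) (y' : Q) :
    tensB_lift
      (fun x y => tensb (tens m' x : tensv M P) (tens n' y : tensv N Q))
      (tensb x' y')
    = tensb (tens m' x' : tensv M P) (tens n' y' : tensv N Q).
  apply: (tensB_liftE (f := fun x y =>
    tensb (tens m' x : tensv M P) (tens n' y : tensv N Q))) => [|x1 d y1].
    split=> [y1|x1] k u v /=.
      by rewrite tens_bilin.2 tensb_bilin.1.
    by rewrite tens_bilin.2 tensb_bilin.2.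
  rewrite -[m' in LHS]ract1 -tensv_ractE tensb_balanced.
  by rewrite tensv_lactE lact1.
rewrite /shuffle -[RHS]inE.
apply: (tensB_liftE (f := fun m n => tensB_lift (fun x y =>
  tensb (tens m x : tensv M P) (tens n y : tensv N Q)) _)) => [|m1 b n1].
  split=> [n1|m1] k u v /=; apply: tensv_lift_comb => x1 y1.
    by rewrite tens_bilin.1 tensb_bilin.1.
  by rewrite tens_bilin.1 tensb_bilin.2.
rewrite !inE -[x in LHS]ract1 -tensv_ractE tensb_balanced.
by rewrite tensv_lactE lact1.
Qed.

Lemma shuffle_lact (a : A) (c : C) (z : MN) (w : PQ) :
  lact (tens a c) (shuffle z w) = shuffle (lact a z) (lact c w).
Proof.
elim/tensB_ind: z => [k z z' IH IH'|m n].
  by rewrite !(shuffle_bilin.1, lact_bilin.2) IH IH'.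
elim/tensB_ind: w => [k w w' IH IH'|x y].
  by rewrite !(shuffle_bilin.2, lact_bilin.2) IH IH'.
rewrite shuffleE [lact a _]tensB_lactE [lact c _]tensB_lactE shuffleE.
by rewrite [LHS]tensB_lactE tensv_lactE.
Qed.

Lemma shuffle_ract (a : A) (c : C) (z : MN) (w : PQ) :
  ract (shuffle z w) (tens a c) = shuffle (ract z a) (ract w c).
Proof.
elim/tensB_ind: z => [k z z' IH IH'|m n].
  by rewrite !(shuffle_bilin.1, ract_bilin.1) IH IH'.
elim/tensB_ind: w => [k w w' IH IH'|x y].
  by rewrite !(shuffle_bilin.2, ract_bilin.1) IH IH'.
rewrite shuffleE [ract _ a]tensB_ractE [ract _ c]tensB_ractE shuffleE.
by rewrite [LHS]tensB_ractE tensv_ractE.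
Qed.

(** Centrality of the shuffled element is linear in the algebra element, and for
    [a (x) c] it reduces to [a z = z a] and [c w = w c]. *)
Lemma retract_tens p q (z : MN) (w : PQ) :
  retract p z -> retract q w ->
  @retract K (tensv A C) (tensv B D) (tensv M P) (tensv N Q)
    (tens2 p q) (shuffle z w).
Proof.
move=> [pP zC pz] [qP wC qw]; have pqP := bimod_pairing_tens pP qP.
split=> // [a|].
  elim/tensv_ind: a => [k a a' IH IH'|a c].
    by rewrite lact_bilin.1 ract_bilin.2 IH IH'.
  by rewrite shuffle_lact shuffle_ract zC wC.
have pE := tensB_liftE (pairing_bilin pP) (pairing_balanced pP).
have qE := tensB_liftE (pairing_bilin qP) (pairing_balanced qP).
have pqE := tensB_liftE (pairing_bilin pqP) (pairing_balanced pqP).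
rewrite -[RHS]/(tens aone aone) -pz -qw.
elim/tensB_ind: z {zC pz} => [k z z' IH IH'|m n].
  by rewrite shuffle_bilin.1 !tensB_lift_linear IH IH' tens_bilin.1.
elim/tensB_ind: w {wC qw} => [k w w' IH IH'|x y].
  by rewrite shuffle_bilin.2 !tensB_lift_linear IH IH' tens_bilin.2.
rewrite shuffleE pE qE pqE.
by apply: tens2E; apply: pairing_bilin.
Qed.

End TensorRetract.

Lemma geJ_tens (K : fieldType) (A B C D : fdAlgType K) :
  geJ A B -> geJ C D -> geJ (tensv A C) (tensv B D).
Proof.
move=> /geJ_retract[M [N [p [z pz]]]] /geJ_retract[P [Q [q [w qw]]]].
apply/geJ_retract; exists (tensv M P), (tensv N Q), (tens2 p q), (shuffle z w).
exact: retract_tens.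
Qed.

Theorem proposition21 (K : fieldType) (A B : fdAlgType K) :
  leJ A B ->
  forall C : fdAlgType K,
    leJ (tensv A C) (tensv B C) /\ leJ (tensv C A) (tensv C B).
Proof. by move=> AB C; split; apply: geJ_tens => //; apply: geJ_refl. Qed.
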